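(* Let $H$ be a self-adjoint operator in a separable Hilbert space $\mathfrak{H}$, let $\mathfrak{K}$ be a separable Hilbert space, and let $F=J\circ M_w\circ\mathfrak{U}_H:\mathfrak{H}\to\mathfrak{K}$ be the rigging operator associated with a weight function $w:\mathbb{R}\to(0,\infty)$, $w\in C_0(\mathbb{R})$, and a bounded operator $J:L^2(\mathbb{R},d\mu_H)\to\mathfrak{K}$. Let $\lambda\in\sigma_{\mathrm p}(H)$ be an isolated eigenvalue of $H$ of finite multiplicity, let $V_\lambda=\ker(H-\lambda I)$, and let $P_\lambda$ be the orthogonal projector onto $V_\lambda$. If the spectral measure of $H$ on $V_\lambda^\perp$ (i.e. the spectral measure of $H_\perp=H|_{V_\lambda^\perp}$) satisfies the Hölder condition at the point $\lambda$, then the limit $$\lim_{y\downarrow 0}F(1-P_\lambda)(H-\lambda-iy)^{-1}(1-P_\lambda)F^*$$ exists in the operator norm on $\mathfrak{K}$.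
   Context: Hilbert spaces are complex. $H$ is a self-adjoint (possibly unbounded) operator in $\mathfrak{H}$ and $\sigma_{\mathrm p}(H)$ is its point spectrum (set of eigenvalues). By the spectral theorem, in the case of multiplicity one (assumed here for simplicity), there is a Borel measure $\mu_H$ on $\mathbb{R}$ and a unitary operator $\mathfrak{U}_H:\mathfrak{H}\to L^2(\mathbb{R},d\mu_H)$ (the spectral transformation) such that $\mathfrak{U}_H H\mathfrak{U}_H^{-1}$ is the operator of multiplication by the independent variable $x$; $\mu_H$ is called the spectral measure of $H$. The spectral measure of $H_\perp=H|_{V_\lambda^\perp}$ is then the restriction of $\mu_H$ to $\mathbb{R}\setminus\{\lambda\}$. $C_0(\mathbb{R})$ denotes the continuous functions on $\mathbb{R}$ that tend to $0$ as $|x|\to\infty$. $M_w$ is the multiplication operator $(M_wf)(x)=w(x)f(x)$ on $L^2(\mathbb{R},d\mu_H)$. Hölder condition: a measure $\mu$ on $\mathbb{R}$ satisfies the Hölder condition at a point $\lambda$ if it is absolutely continuous in some neighborhood of $\lambda$, $d\mu(x)=\rho(x)\,dx$, and its density $\rho$ is locally Hölder at $\lambda$ with some exponent $\alpha\in(0,1]$, that is, $|\rho(x)-\rho(\lambda)|\le C|x-\lambda|^\alpha$ for some constant $C$ and all $x$ in a neighborhood of $\lambda$. *)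

(* Defs.v *)
From HB Require Import structures.
From mathcomp Require Import all_boot all_order all_algebra.
From mathcomp Require Import complex.
From mathcomp Require Import all_classical all_reals all_analysis.
From mathcomp Require Import measurable_realfun.

Set Implicit Arguments.
Unset Strict Implicit.
Unset Printing Implicit Defensive.

Import Order.TTheory GRing.Theory Num.Theory.
Import numFieldNormedType.Exports.
Import ComplexField.Normc.

Local Open Scope classical_set_scope.
Local Open Scope ring_scope.
Local Open Scope complex_scope.

(* The complex space L^2(mu): measurable square-integrable functions T -> R[i],
   modulo equality mu-almost everywhere. *)

Section square_integrable.
Context d (T : measurableType d) (R : realType).
Variable mu : {measure set T -> \bar R}.
Implicit Types f g : T -> R[i].

Definition cmeasurable f :=
  measurable_fun [set: T] (fun x => complex.Re (f x)) /\
  measurable_fun [set: T] (fun x => complex.Im (f x)).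

Definition sqint f := cmeasurable f /\ finite_norm mu 2%:E (fun x => normc (f x)).

Lemma normcEsqrt (z : R[i]) :
  normc z = Num.sqrt (complex.Re z ^+ 2 + complex.Im z ^+ 2).
Proof. by case: z. Qed.

Lemma normc_ge0 (z : R[i]) : 0 <= normc z.
Proof. by rewrite normcEsqrt sqrtr_ge0. Qed.

Lemma normrCE (z : R[i]) : `|z| = (normc z)%:C.
Proof. by case: z. Qed.

Lemma measurable_normc f : cmeasurable f ->
  measurable_fun [set: T] (fun x => normc (f x)).
Proof.
move=> [mr mi]; under eq_fun do rewrite normcEsqrt.
apply: (@measurableT_comp _ _ _ _ _ _ (@Num.sqrt R)).
  by apply: continuous_measurable_fun; exact: sqrt_continuous.
by apply: measurable_funD; exact: measurable_funX.
Qed.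

Lemma cmeasurableD f g : cmeasurable f -> cmeasurable g ->
  cmeasurable (f + g).
Proof.
move=> [fr fi] [gr gi]; split.
  rewrite (_ : (fun x => _) = (fun x => complex.Re (f x)) \+ (fun x => complex.Re (g x))).
    exact: measurable_funD.
  by apply/funext => x /=; rewrite fctE; case: (f x) (g x) => [a b] [a' b'].
rewrite (_ : (fun x => _) = (fun x => complex.Im (f x)) \+ (fun x => complex.Im (g x))).
  exact: measurable_funD.
by apply/funext => x /=; rewrite fctE; case: (f x) (g x) => [a b] [a' b'].
Qed.

Lemma cmeasurableM f g : cmeasurable f -> cmeasurable g ->
  cmeasurable (fun x => f x * g x).
Proof.
move=> [fr fi] [gr gi]; split.
  rewrite (_ : (fun x => _) = (fun x => complex.Re (f x) * complex.Re (g x)) \-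
     (fun x => complex.Im (f x) * complex.Im (g x))).
    by apply: measurable_funB; exact: measurable_funM.
  by apply/funext => x /=; case: (f x) (g x) => [a b] [a' b'].
rewrite (_ : (fun x => _) = (fun x => complex.Re (f x) * complex.Im (g x)) \+
     (fun x => complex.Im (f x) * complex.Re (g x))).
  by apply: measurable_funD; exact: measurable_funM.
by apply/funext => x /=; case: (f x) (g x) => [a b] [a' b'].
Qed.

Lemma cmeasurable_cst (a : R[i]) : cmeasurable (fun=> a).
Proof. by split; exact: measurable_cst. Qed.

Lemma le_Lnorm2 (f g : T -> R) : measurable_fun [set: T] f ->
  measurable_fun [set: T] g -> (forall x, `|f x| <= `|g x|) ->
  ('N[mu]_2%:E[EFin \o f] <= 'N[mu]_2%:E[EFin \o g])%E.
Proof.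
move=> mf mg fg; rewrite unlock.
have mp (h : T -> R) : measurable_fun [set: T] h ->
    measurable_fun [set: T] (fun x => (`|(EFin \o h) x| `^ 2)%E).
  move=> mh; apply: (measurableT_comp (measurable_poweR _)).
  by apply: measurableT_comp => //; exact/measurable_EFinP.
apply: gt0_ler_poweR; rewrite ?invr_ge0//.
- by rewrite in_itv/= leey andbT; apply: integral_ge0 => x _; rewrite lee_fin powR_ge0.
- by rewrite in_itv/= leey andbT; apply: integral_ge0 => x _; rewrite lee_fin powR_ge0.
- apply: ge0_le_integral => //; try exact: mp.
  + by move=> x _; exact: poweR_ge0.
  + move=> x _ /=; rewrite lee_fin ge0_ler_powR ?nnegrE//.
Qed.

Let le1_2 : (1%E <= 2%:E :> \bar R)%E.
Proof. by rewrite lee_fin ler1n. Qed.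

Definition cnorm2 f : \bar R := 'N[mu]_2%:E[EFin \o (fun x => normc (f x))]%E.

Lemma cnorm2D f g : cmeasurable f -> cmeasurable g ->
  (cnorm2 (f + g)%R <= cnorm2 f + cnorm2 g)%E.
Proof.
move=> mf mg.
have mnf := measurable_normc mf; have mng := measurable_normc mg.
apply: le_trans (eminkowski mu mnf mng le1_2).
apply: le_Lnorm2 => //.
- by apply: measurable_normc; exact: cmeasurableD.
- exact: measurable_funD.
- move=> x; rewrite /= !ger0_norm ?addr_ge0 ?normc_ge0//.
  exact: le_normcD.
Qed.

Lemma cnorm2Z (a : R[i]) f : sqint f ->
  cnorm2 (fun x => a * f x)%R = ((normc a)%:E * cnorm2 f)%E.
Proof.
move=> [mf lf].
have Lf : (fun x => normc (f x)) \in Lfun mu 2%:E.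
  by apply/andP; rewrite !inE/=; split=> //; exact: measurable_normc.
have := LnormZ (Lfun_Sub le1_2 Lf) (normc a).
rewrite ger0_norm ?normc_ge0// => <-.
by rewrite /cnorm2; congr Lnorm; apply/funext => x /=; rewrite normcM.
Qed.

Lemma sqintD f g : sqint f -> sqint g -> sqint (f + g).
Proof.
move=> [mf lf] [mg lg]; split; first exact: cmeasurableD.
by apply: le_lt_trans (cnorm2D mf mg) _; rewrite lte_add_pinfty.
Qed.

Lemma sqintZ (a : R[i]) f : sqint f -> sqint (a *: f).
Proof.
move=> sf; have [mf lf] := sf; split.
  by apply: (cmeasurableM _ mf); exact: cmeasurable_cst.
rewrite /finite_norm; have := cnorm2Z a sf; rewrite /cnorm2 => ->.
by rewrite lte_mul_pinfty// lee_fin normc_ge0.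
Qed.

Lemma sqint0 : sqint 0.
Proof.
split; first exact: cmeasurable_cst.
rewrite /finite_norm (_ : _ \o _ = cst 0%E) ?Lnorm0//.
by apply/funext => x /=; rewrite expr0n/= addr0 sqrtr0.
Qed.

Lemma sqintN f : sqint f -> sqint (- f).
Proof. by move=> /(sqintZ (-1)); rewrite scaleN1r. Qed.

End square_integrable.

Section L2.
Context d (T : measurableType d) (R : realType).
Variable mu : {measure set T -> \bar R}.

Definition cL2fun := {f : T -> R[i] | `[< sqint mu f >]}.
HB.instance Definition _ := Choice.on cL2fun.

Definition cL2eq (f g : cL2fun) : bool := `[< sval f = sval g %[ae mu] >].

Let cL2eq_refl : reflexive cL2eq.
Proof. by move=> f; apply/asboolP; exact: ae_eq_refl. Qed.

Let cL2eq_sym : symmetric cL2eq.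
Proof. by move=> f g; apply/idP/idP => /asboolP h; apply/asboolP/ae_eq_sym. Qed.

Let cL2eq_trans : transitive cL2eq.
Proof.
by move=> f g h /asboolP gf /asboolP fh; apply/asboolP/(ae_eq_trans gf fh).
Qed.

Canonical cL2eq_canonical := EquivRel cL2eq cL2eq_refl cL2eq_sym cL2eq_trans.

Local Open Scope quotient_scope.

Definition L2 : Type := {eq_quot cL2eq}.
HB.instance Definition _ := Choice.on L2.
HB.instance Definition _ := EqQuotient.on L2.

(* A representative of the class; it is defined up to mu-a.e. equality. *)
Definition L2_fun (f : L2) : T -> R[i] := sval (repr f).
Coercion L2_fun : L2 >-> Funclass.

Lemma L2_sqint (f : L2) : sqint mu f.
Proof. exact: asboolW (svalP (repr f)). Qed.

Definition mkL2 (f : T -> R[i]) (sf : sqint mu f) : L2 :=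
  \pi_L2 (exist _ f (asboolT sf)).

Lemma mkL2E f (sf : sqint mu f) : (mkL2 sf : T -> R[i]) = f %[ae mu].
Proof.
have : repr (mkL2 sf) == exist _ f (asboolT sf) %[mod L2] by rewrite reprK.
by rewrite eqmodE => /asboolP.
Qed.

Lemma eqL2P (f g : L2) : (f : T -> R[i]) = g %[ae mu] <-> f = g.
Proof.
split=> [fg|->]; last exact: ae_eq_refl.
rewrite -[f]reprK -[g]reprK; apply/eqP; rewrite eqmodE; exact/asboolP.
Qed.

Definition L2_zero : L2 := mkL2 (sqint0 mu).
Definition L2_opp (f : L2) : L2 := mkL2 (sqintN (L2_sqint f)).
Definition L2_add (f g : L2) : L2 := mkL2 (sqintD (L2_sqint f) (L2_sqint g)).
Definition L2_scale (a : R[i]) (f : L2) : L2 := mkL2 (sqintZ a (L2_sqint f)).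

Let aeP (f : T -> R[i]) (sf : sqint mu f) : \forall x \ae mu, mkL2 sf x = f x.
Proof. by apply: filterS (mkL2E sf) => x; exact. Qed.

Let aeapp (P Q : T -> Prop) : (\forall x \ae mu, P x) ->
  (\forall x \ae mu, P x -> Q x) -> \forall x \ae mu, Q x.
Proof. by move=> p pq; apply: filterS2 p pq => x px; exact. Qed.

Let addE f g : \forall x \ae mu, L2_add f g x = f x + g x.
Proof. exact: aeP. Qed.

Let oppE f : \forall x \ae mu, L2_opp f x = - f x.
Proof. exact: aeP. Qed.

Let scaleE a f : \forall x \ae mu, L2_scale a f x = a * f x.
Proof. exact: aeP. Qed.

Let zeroE : \forall x \ae mu, L2_zero x = 0.
Proof. exact: aeP. Qed.

Let L2_addA : associative L2_add.
Proof.
move=> f g h; apply/eqL2P.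
apply: (aeapp (addE f (L2_add g h))); apply: (aeapp (addE g h)).
apply: (aeapp (addE (L2_add f g) h)); apply: (aeapp (addE f g)).
by apply: nearW => x e1 e2 e3 e4 _; rewrite e2 e1 e4 e3 addrA.
Qed.

Let L2_addC : commutative L2_add.
Proof.
move=> f g; apply/eqL2P.
apply: (aeapp (addE f g)); apply: (aeapp (addE g f)).
by apply: nearW => x e1 e2 _; rewrite e1 e2 addrC.
Qed.

Let L2_add0 : left_id L2_zero L2_add.
Proof.
move=> f; apply/eqL2P.
apply: (aeapp (addE L2_zero f)); apply: (aeapp zeroE).
by apply: nearW => x e1 e2 _; rewrite e2 e1 add0r.
Qed.

Let L2_addN : left_inverse L2_zero L2_opp L2_add.
Proof.
move=> f; apply/eqL2P.
apply: (aeapp (addE (L2_opp f) f)); apply: (aeapp (oppE f)).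
apply: (aeapp zeroE).
by apply: nearW => x e1 e2 e3 _; rewrite e3 e2 e1 addNr.
Qed.

HB.instance Definition _ :=
  GRing.isZmodule.Build L2 L2_addA L2_addC L2_add0 L2_addN.

Let L2_scaleA a b f : L2_scale a (L2_scale b f) = L2_scale (a * b) f.
Proof.
apply/eqL2P.
apply: (aeapp (scaleE a (L2_scale b f))); apply: (aeapp (scaleE b f)).
apply: (aeapp (scaleE (a * b) f)).
by apply: nearW => x e1 e2 e3 _; rewrite e3 e2 e1 mulrA.
Qed.

Let L2_scale1 : left_id 1 L2_scale.
Proof.
move=> f; apply/eqL2P; apply: (aeapp (scaleE 1 f)).
by apply: nearW => x e1 _; rewrite e1 mul1r.
Qed.

Let L2_scaleDr : right_distributive L2_scale +%R.
Proof.
move=> a f g; apply/eqL2P.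
apply: (aeapp (scaleE a (f + g))); apply: (aeapp (addE f g)).
apply: (aeapp (addE (L2_scale a f) (L2_scale a g))).
apply: (aeapp (scaleE a f)); apply: (aeapp (scaleE a g)).
by apply: nearW => x e1 e2 e3 e4 e5 _; rewrite e5 e4 e3 e2 e1 mulrDr.
Qed.

Let L2_scaleDl f : {morph L2_scale^~ f : a b / a + b}.
Proof.
move=> a b; apply/eqL2P.
apply: (aeapp (scaleE (a + b) f)); apply: (aeapp (scaleE a f)).
apply: (aeapp (scaleE b f)).
apply: (aeapp (addE (L2_scale a f) (L2_scale b f))).
by apply: nearW => x e1 e2 e3 e4 _; rewrite e4 e1 e2 e3 mulrDl.
Qed.

HB.instance Definition _ := GRing.Zmodule_isLmodule.Build R[i] L2
  L2_scaleA L2_scale1 L2_scaleDr L2_scaleDl.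

Lemma L2_addE (f g : L2) : \forall x \ae mu, (f + g : L2) x = f x + g x.
Proof. exact: addE. Qed.

Lemma L2_oppE (f : L2) : \forall x \ae mu, (- f : L2) x = - f x.
Proof. exact: oppE. Qed.

Lemma L2_scaleE a (f : L2) : \forall x \ae mu, (a *: f : L2) x = a * f x.
Proof. exact: scaleE. Qed.

Lemma L2_zeroE : \forall x \ae mu, (0 : L2) x = 0.
Proof. exact: zeroE. Qed.

Definition L2_norm (f : L2) : R[i] := (fine (cnorm2 mu f))%:C.

Lemma cnorm2_fin (f : L2) : cnorm2 mu f \is a fin_num.
Proof.
rewrite ge0_fin_numE; last exact: Lnorm_ge0.
by have [] := L2_sqint f.
Qed.

Lemma ae_eq_cnorm2 (f g : T -> R[i]) : cmeasurable f -> cmeasurable g ->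
  (\forall x \ae mu, f x = g x) -> cnorm2 mu f = cnorm2 mu g.
Proof.
move=> mf mg fg; rewrite /cnorm2 unlock; congr (_ `^ _)%E.
have mp (h : T -> R[i]) : cmeasurable h ->
    measurable_fun [set: T] (fun x => (`|(normc (h x))%:E| `^ 2)%E).
  move=> mh; apply: (measurableT_comp (measurable_poweR _)).
  apply: measurableT_comp => //; apply/measurable_EFinP.
  exact: measurable_normc.
apply: ge0_ae_eq_integral => //; try exact: mp.
- by move=> x _; exact: poweR_ge0.
- by move=> x _; exact: poweR_ge0.
- by apply: filterS fg => x /= fgx _; rewrite fgx.
Qed.

Let L2_cmeas (f : L2) : cmeasurable f.
Proof. by have [] := L2_sqint f. Qed.

Let L2_normD (f g : L2) : L2_norm (f + g) <= L2_norm f + L2_norm g.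
Proof.
rewrite /L2_norm -rmorphD lecR -lee_fin EFinD !fineK ?cnorm2_fin//.
rewrite (ae_eq_cnorm2 _ _ (L2_addE f g))//; last first.
  exact: (cmeasurableD (L2_cmeas f) (L2_cmeas g)).
exact: (cnorm2D mu (L2_cmeas f) (L2_cmeas g)).
Qed.

Let L2_normZ a (f : L2) : L2_norm (a *: f) = `|a| * L2_norm f.
Proof.
rewrite /L2_norm normrCE -rmorphM; congr (_%:C).
apply: EFin_inj; rewrite EFinM !fineK ?cnorm2_fin//.
rewrite (ae_eq_cnorm2 _ _ (L2_scaleE a f))//; last first.
  exact: (cmeasurableM (@cmeasurable_cst _ T _ a) (L2_cmeas f)).
exact: cnorm2Z (L2_sqint f).
Qed.

Let L2_norm_eq0 (f : L2) : L2_norm f = 0 -> f = 0.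
Proof.
move=> [] f0.
have {}f0 : cnorm2 mu f = 0%E by rewrite -(fineK (cnorm2_fin f)) f0.
have mf : measurable_fun [set: T] (fun x => (normc (f x))%:E).
  exact/measurable_EFinP/measurable_normc.
have p0 : (0 < 2%:E :> \bar R)%E by rewrite lte_fin.
have /= h := Lnorm_eq0_eq0 mf p0 f0.
apply/eqL2P; apply: (aeapp h); apply: (aeapp L2_zeroE).
by apply: nearW => x e0 hx _; rewrite e0; apply: eq0_normc; have [] := hx I.
Qed.

HB.instance Definition _ := Lmodule_isNormed.Build R[i] L2
  L2_normD L2_normZ L2_norm_eq0.

Definition L2_dot (f g : L2) : R[i] :=
  Rintegral mu [set: T] (fun x => complex.Re (f x * (g x)^*)) +i*
  Rintegral mu [set: T] (fun x => complex.Im (f x * (g x)^*)).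

Lemma L2_dot_norm (f : L2) : L2_dot f f = `|f| ^+ 2.
Proof.
rewrite [in RHS]/Num.norm/= /L2_norm -rmorphXn/=.
have E z : z * z^* = (normc z ^+ 2)%:C :> R[i].
  by rewrite -sqr_normc normrCE -rmorphXn.
rewrite /L2_dot /real_complex_def; congr (_ +i* _); last first.
  by rewrite /Rintegral; under eq_integral do rewrite E/=; rewrite integral0.
have c0 : (0 <= cnorm2 mu f)%E by exact: Lnorm_ge0.
have I : (\int[mu]_x (complex.Re (f x * (f x)^*))%:E = cnorm2 mu f `^ 2)%E.
  rewrite /cnorm2 poweR_Lnorm//; apply: eq_integral => x _.
  by rewrite E/= ger0_norm ?normc_ge0// powR_mulrn// normc_ge0.
apply: EFin_inj; rewrite -[in RHS]powR_mulrn ?fine_ge0// -poweR_EFin.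
by rewrite /Rintegral I !fineK ?fin_num_poweR ?cnorm2_fin.
Qed.
End L2.

Arguments L2 {d T R} mu.

Section multiplication.
Context d (T : measurableType d) (R : realType).
Variable mu : {measure set T -> \bar R}.

Definition mult_dom (g : T -> R[i]) : set (L2 mu) :=
  [set f : L2 mu | sqint mu (fun x => g x * f x)].

(* The value outside mult_dom g is 0 by convention. *)
Definition mult_op (g : T -> R[i]) (f : L2 mu) : L2 mu :=
  match pselect (sqint mu (fun x => g x * f x)) with
  | left gf => mkL2 gf
  | right _ => 0
  end.

End multiplication.

Arguments mult_dom {d T R} mu g.
Arguments mult_op {d T R} mu g f.

Record hilbertType (R : realType) := HilbertType {
  hilbert_sort :> completeNormedModType R[i];
  hdot : {dot hilbert_sort for (@Num.conj R[i])};
  hdot_norm : forall x, hdot x x = `|x| ^+ 2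
}.

Notation "''[' x , y ]" := (hdot _ x y) : ring_scope.

Definition separable (T : topologicalType) :=
  exists2 D : set T, countable D & dense D.

Section bounded_operators.
Context (R : realType) (V W : normedModType R[i]).

Definition bounded_op (A : V -> W) :=
  exists M : R, forall v, `|A v| <= M%:C * `|v|.

Definition opnorm (A : V -> W) : \bar R :=
  ereal_sup [set (complex.Re `|A v|)%:E | v in [set v | `|v| <= 1]].

End bounded_operators.

Record unbounded_op (R : realType) (V : lmodType R[i]) := UnboundedOp {
  op_dom : set V;
  op_fun :> V -> V;
  op_dom0 : op_dom 0;
  op_domP : forall a u v, op_dom u -> op_dom v -> op_dom (a *: u + v);
  op_linear : forall a u v, op_dom u -> op_dom v ->
    op_fun (a *: u + v) = a *: op_fun u + op_fun v
}.

Section operators.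
Context (R : realType) (V : hilbertType R).
Implicit Type H : unbounded_op V.

(* Equality of H and H^* as unbounded operators, hence also of their domains;
   (v, w) is in the graph of H^* iff '[H u, v] = '[u, w] for all u in the
   domain of H. *)
Definition self_adjoint H :=
  dense (op_dom H) /\
  forall v w, (forall u, op_dom H u -> '[H u, v] = '[u, w]) <->
              (op_dom H v /\ H v = w).

Definition op_eigenspace H (z : R[i]) : set V :=
  [set v | op_dom H v /\ H v = z *: v].

Definition point_spectrum H : set R[i] :=
  [set z | exists2 v, op_eigenspace H z v & v != 0].

(* (H - z)^-1, with value 0 outside the range of H - z. *)
Definition resolvent H (z : R[i]) (v : V) : V :=
  xget 0 [set u | op_dom H u /\ H u - z *: u = v].

Definition resolvent_set H : set R[i] :=
  [set z | set_bij (op_dom H) [set: V] (fun u => H u - z *: u) /\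
           bounded_op (resolvent H z)].

Definition spectrum H : set R[i] := ~` resolvent_set H.

Definition finite_dim (S : set V) := exists n (b : 'I_n -> V),
  S = [set \sum_(k < n) c k *: b k | c in [set: 'I_n -> R[i]]].

Definition orth_proj (S : set V) (v : V) : V :=
  xget 0 [set p | S p /\ forall q, S q -> '[v - p, q] = 0].

(* Isolated in the whole spectrum, as usual for points of the discrete spectrum,
   not merely among the eigenvalues. *)
Definition isolated_eigenvalue H (z : R[i]) :=
  point_spectrum H z /\ isolated (spectrum H : set R[i]^o) z.

End operators.

Definition adjoint (R : realType) (V W : hilbertType R) (F : V -> W) (w : W) : V :=
  xget 0 [set u | forall v, '[F v, w] = '[v, u]].

Section spectral_measure.
Context (R : realType).
Implicit Type mu : {measure set (measurableTypeR R) -> \bar R}.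

(* mu and U are a spectral measure and a spectral transformation of the operator
   H (of multiplicity one): U is unitary, and U H U^-1 is the operator of
   multiplication by x, with its maximal domain. *)
Definition spectral_transformation (V : hilbertType R) (H : unbounded_op V)
    mu (U : {linear V -> L2 mu}) :=
  [/\ forall u v, L2_dot (U u) (U v) = '[u, v],
      forall f, exists u, U u = f,
      forall u, op_dom H u <-> mult_dom mu (fun x : R => x%:C) (U u) &
      forall u, op_dom H u -> U (H u) = mult_op mu (fun x : R => x%:C) (U u)].

Definition C0 (w : R -> R) :=
  [/\ continuous w, w x @[x --> +oo] --> 0 & w x @[x --> -oo] --> 0].

Definition weight_op mu (w : R -> R) : L2 mu -> L2 mu :=
  mult_op mu (fun x : R => (w x)%:C).

Definition rigging (V K : hilbertType R) mu (U : V -> L2 mu) (w : R -> R)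
    (J : L2 mu -> K) : V -> K := J \o weight_op w \o U.

(* The spectral measure of the restriction of H to the orthogonal complement of
   the eigenspace of a, for H with spectral measure mu. *)
Definition measure_off mu (a : R) : set (measurableTypeR R) -> \bar R :=
  mrestr mu (measurableC (measurable_set1 a)).

Definition holder_at (nu : set (measurableTypeR R) -> \bar R) (a : R) :=
  exists (r : R) (rho : R -> R),
  [/\ 0 < r,
      measurable_fun `]a - r, a + r[ rho /\
        (forall x, x \in `]a - r, a + r[ -> 0 <= rho x),
      forall A : set (measurableTypeR R), measurable A ->
        A `<=` `]a - r, a + r[ ->
        nu A = (\int[lebesgue_measure]_(x in A) (rho x)%:E)%E &
      exists alpha C : R, 0 < alpha <= 1 /\
        \forall x \near a, `|rho x - rho a| <= C * `|x - a| `^ alpha].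

End spectral_measure.

(* Main.v *)
From HB Require Import structures.
Require Import Defs.
From mathcomp Require Import all_boot all_order all_algebra.
From mathcomp Require Import complex ring lra.
From mathcomp Require Import all_classical all_reals all_analysis.
From mathcomp Require Import measurable_realfun.

(** Write [hat v] for the function representing [U v], so that [H] acts on it
    as multiplication by [x].

    The point [lambda] is isolated in the spectrum, so every other real point [a]
    near it has a bounded resolvent.  A vector whose transform lives within [d]
    of [a] is shrunk by [H - a] by a factor [d]; when [d] is smaller than the
    inverse of the norm of the resolvent this forces the vector to vanish.
    Cutting transforms off to small intervals and covering the punctured
    neighbourhood of [lambda] by countably many of them, one finds an [e > 0]
    such that every [hat v] vanishes almost everywhere on
    [0 < |x - lambda| < e] (spectral_gap).

    The projection onto the eigenspace multiplies [hat v] by the indicator of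
    [lambda] (hat_eigenprojection), so on its orthogonal complement only the
    points with [|x - lambda| >= e] count.  There, with [t = x - lambda], the
    resolvent at [lambda + i y] multiplies by [1 / (t - i y)], which differs
    from [1 / t] by at most [y / e ^ 2].  Multiplication by [1 / t] for
    [|t| >= e] is therefore the limit, at linear speed and in operator norm, of
    the compressed resolvents (reduced_resolvent_approx).

    The rigging operator [F] is bounded because [w] and [J] are, and [F] has a
    bounded linear adjoint by the Riesz representation theorem
    (riesz_representation, adjointP).  Sandwiching the estimate between [F] and
    its adjoint only changes the constant, and the limit is
    [F S F^*] with [S] the multiplication above. *)

Set Implicit Arguments.
Unset Strict Implicit.
Unset Printing Implicit Defensive.

Import Order.TTheory GRing.Theory Num.Theory.
Import numFieldNormedType.Exports.

Local Open Scope classical_set_scope.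
Local Open Scope ring_scope.
Local Open Scope complex_scope.

Local Notation Re := complex.Re.
Local Notation Im := complex.Im.
Local Notation normc := ComplexField.Normc.normc.

(** * Norms and scalar products as real numbers *)

Lemma normc_real (R : realType) (a : R) : normc a%:C = `|a|.
Proof. by rewrite normcEsqrt/= expr0n/= addr0 sqrtr_sqr. Qed.

Lemma normRe_le_normc (R : realType) (z : R[i]) : `|Re z| <= normc z.
Proof. by rewrite -lecR -normrCE; case: z => a b; rewrite normc_ge_Re. Qed.

(** The norm of a complex normed module takes its values in [R[i]]; real-valued
    norms make order reasoning and the square-norm expansions possible. *)
Section real_norm.
Context (R : realType) (V : normedModType R[i]).
Implicit Types u v : V.

Definition rnorm v : R := Re `|v|.

Lemma rnormE v : `|v| = (rnorm v)%:C.
Proof. by rewrite /rnorm RRe_real ?normr_real. Qed.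

Lemma rnorm_ge0 v : 0 <= rnorm v.
Proof. by rewrite -lecR -rnormE normr_ge0. Qed.

Lemma rnormD u v : rnorm (u + v) <= rnorm u + rnorm v.
Proof. by rewrite -lecR rmorphD/= -!rnormE ler_normD. Qed.

Lemma rnormZ a v : rnorm (a *: v) = normc a * rnorm v.
Proof. by apply: complexI; rewrite rmorphM/= -normrCE -!rnormE normrZ. Qed.

Lemma rnorm_eq0 v : rnorm v = 0 -> v = 0.
Proof. by move=> v0; apply/eqP; rewrite -normr_eq0 rnormE v0. Qed.

Lemma rnorm0 : rnorm 0 = 0.
Proof. by rewrite /rnorm normr0. Qed.

End real_norm.

Lemma bounded_op_rnormP (R : realType) (V W : normedModType R[i]) (A : V -> W) :
  bounded_op A <-> exists2 M : R, 0 <= M & forall v, rnorm (A v) <= M * rnorm v.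
Proof.
split=> [[M AM]|[M _ AM]].
  exists (Num.max M 0); first by rewrite le_max lexx orbT.
  move=> v; have := AM v; rewrite !rnormE -rmorphM lecR => /le_trans; apply.
  by rewrite ler_wpM2r ?rnorm_ge0// le_max lexx.
by exists M => v; rewrite !rnormE -rmorphM lecR.
Qed.

Section dot.
Context (R : realType) (V : hilbertType R).
Implicit Types (u v w : V) (a : R[i]).

Lemma dotC u v : '[u, v] = (conjc '[v, u])%C.
Proof. by rewrite hermC/= expr0 mul1r. Qed.

Lemma dotDl u v w : '[u + v, w] = '[u, w] + '[v, w].
Proof. exact: linearDl. Qed.

Lemma dotBl u v w : '[u - v, w] = '[u, w] - '[v, w].
Proof. exact: linearBl. Qed.

Lemma dotZl a u v : '[a *: u, v] = a * '[u, v].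
Proof. exact: linearZl_LR. Qed.

Lemma dotDr u v w : '[u, v + w] = '[u, v] + '[u, w].
Proof. exact: linearDr. Qed.

Lemma dotBr u v w : '[u, v - w] = '[u, v] - '[u, w].
Proof. exact: linearBr. Qed.

Lemma dotZr a u v : '[u, a *: v] = (conjc a)%C * '[u, v].
Proof. exact: linearZr_LR. Qed.

Lemma dot_rnorm u : '[u, u] = (rnorm u ^+ 2)%:C.
Proof. by rewrite hdot_norm rnormE rmorphXn. Qed.

Lemma dot_inj u v : (forall w, '[w, u] = '[w, v]) -> u = v.
Proof.
move=> uv; apply/eqP; rewrite -subr_eq0; apply/eqP/rnorm_eq0.
have := dot_rnorm (u - v); rewrite dotBr uv subrr => -[] /esym/eqP.
by rewrite sqrf_eq0 => /eqP.
Qed.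

Lemma rnorm2D u v :
  rnorm (u + v) ^+ 2 = rnorm u ^+ 2 + rnorm v ^+ 2 + 2 * Re '[u, v].
Proof.
have := dot_rnorm (u + v).
rewrite dotDl !dotDr !dot_rnorm (dotC v u) => /(congr1 (@Re R)) /= <-.
case: '[u, v] => a b /=; ring.
Qed.

(** With [a = '[u, v]] and [b = |v|^2], the vector [b u - a v] is, up to the
    factor [b], the component of [u] orthogonal to [v]; the inequality says that
    its squared norm is nonnegative. *)
Lemma cauchy_schwarz u v : normc '[u, v] <= rnorm u * rnorm v.
Proof.
have [v0|v0] := eqVneq (rnorm v) 0.
  rewrite (rnorm_eq0 v0) -[X in '[_, X]](scale0r u) dotZr conjc0 mul0r.
  by rewrite ComplexField.Normc.normc0 mulr_ge0// rnorm_ge0.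
rewrite -(ler_pXn2r (n := 2))// ?nnegrE ?normc_ge0 ?mulr_ge0 ?rnorm_ge0//.
set a := '[u, v]; set b := rnorm v ^+ 2.
have b0 : 0 < b by rewrite exprn_gt0// lt_neqAle eq_sym v0 rnorm_ge0.
have := sqr_ge0 (rnorm (b%:C *: u - a *: v)).
have -> : rnorm (b%:C *: u - a *: v) ^+ 2 = b * (b * rnorm u ^+ 2 - normc a ^+ 2).
  have := dot_rnorm (b%:C *: u - a *: v).
  rewrite dotBl !dotBr !dotZl !dotZr !dot_rnorm -/b (dotC v u) -/a.
  rewrite normcEsqrt sqr_sqrtr ?addr_ge0 ?sqr_ge0//.
  by case: a => x y /(congr1 (@Re R)) /= <-; ring.
by rewrite pmulr_rge0// subr_ge0 exprMn mulrC.
Qed.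

End dot.

(** * Riesz representation and adjoints *)

(** Completeness, in terms of real-valued norms. *)
Lemma cauchy_rnorm_cvg (R : realType) (V : hilbertType R) (u : nat -> V) :
  (forall e : R, 0 < e -> exists N, forall n, (N <= n)%N -> rnorm (u N - u n) < e) ->
  exists l, forall e : R, 0 < e -> exists N, forall n, (N <= n)%N -> rnorm (l - u n) < e.
Proof.
move=> uC.
have /cauchy_cvg /cvg_ex[l ul] : cauchy (u @ \oo).
  apply: cauchy_exP => e e0.
  have eR : e = (Re e)%:C by rewrite RRe_real// gtr0_real.
  move: e0; rewrite eR ltcR => e0.
  have [N uN] := uC _ e0; exists (u N), N => // n /= Nn.
  by rewrite -ball_normE/= rnormE ltcR uN.
exists l => e e0.
move/cvgrPdist_lt : ul => /(_ e%:C); rewrite ltcR => /(_ e0)[N _ uN].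
exists N => n Nn.
by rewrite -ltcR -rnormE; exact: uN.
Qed.

(** The representing vector minimises the energy
    [E v = rnorm v ^+ 2 - 2 * Re (phi v)], which equals the squared distance from
    [v] to that vector up to a constant.  By the parallelogram law minimising
    sequences are Cauchy, and the vanishing of the first variation of [E] at the
    minimum gives the real part of the identity; replacing [v] by [i v] gives
    the imaginary part. *)
Lemma riesz_representation (R : realType) (V : hilbertType R) (phi : {scalar V}) (M : R) :
  (forall v, normc (phi v) <= M * rnorm v) ->
  exists u, forall v, phi v = '[v, u].
Proof.
move=> phiM.
have Rephi v : `|Re (phi v)| <= M * rnorm v.
  exact: le_trans (normRe_le_normc _) (phiM v).
pose E v := rnorm v ^+ 2 - 2 * Re (phi v).
have EM v : - M ^+ 2 <= E v.
  have := Rephi v; rewrite ler_norml => /andP[_ h].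
  have := sqr_ge0 (rnorm v - M); rewrite /E; nra.
have hE : has_inf [set E v | v in [set: V]].
  by split; [exists (E 0), 0|exists (- M ^+ 2) => _ [v _ <-]].
set m := inf [set E v | v in [set: V]].
have mE v : m <= E v by apply: ge_inf; [case: hE|exists v].
have DRe v w : Re (phi (v + w)) = Re (phi v) + Re (phi w).
  by rewrite linearD; case: (phi v) (phi w) => [? ?] [].
have ZRe (t : R) v : Re (phi (t%:C *: v)) = t * Re (phi v).
  by rewrite linearZ/=; case: (phi v) => [a b]/=; rewrite mul0r subr0.
have rZ (t : R) v : rnorm (t%:C *: v) ^+ 2 = t ^+ 2 * rnorm v ^+ 2.
  by rewrite rnormZ exprMn normcEsqrt/= expr0n/= addr0 sqrtr_sqr real_normK ?num_real.
have Eexp u v t : E (u + t%:C *: v) =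
    E u + t * (2 * Re '[v, u] - 2 * Re (phi v)) + t ^+ 2 * rnorm v ^+ 2.
  rewrite /E rnorm2D rZ DRe ZRe dotZr dotC.
  by case: '[v, u] => a b /=; ring.
(* Parallelogram law, from the value of E at the midpoint being at least m. *)
have Epar u v : rnorm (u - v) ^+ 2 <= 2 * (E u - m) + 2 * (E v - m).
  have := mE (v + (2^-1)%:C *: (u - v)).
  have := Eexp v (u - v) 1; rewrite scale1r addrC subrK => ->.
  by rewrite Eexp; lra.
have [u uE] : exists u : nat -> V, forall n, E (u n) < m + n.+1%:R^-1.
  suff /choice[u uE] : forall n : nat, exists v, E v < m + n.+1%:R^-1 by exists u.
  move=> n; have n0 : 0 < n.+1%:R^-1 :> R by rewrite invr_gt0.
  have [_ [v _ <-] vE] := inf_adherent n0 hE.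
  by exists v.
have small (e : R) : 0 < e -> exists N : nat, forall n, (N <= n)%N -> n.+1%:R^-1 < e.
  move=> e0; exists (Num.truncn e^-1) => n Nn.
  rewrite invf_plt ?posrE//; apply: lt_le_trans (truncnS_gt _) _.
  by rewrite ler_nat.
have [e e0|l ul] := @cauchy_rnorm_cvg _ _ u.
  have e4 : 0 < e ^+ 2 / 4 by rewrite divr_gt0 ?exprn_gt0.
  have [N Nsmall] := small _ e4.
  exists N => n Nn; rewrite -(ltr_pXn2r (n := 2))// ?nnegrE ?rnorm_ge0 ?ltW//.
  have := Epar (u N) (u n); have := uE N; have := uE n.
  have := Nsmall _ Nn; have := Nsmall _ (leqnn N).
  move: (E (u n)) (E (u N)) (n.+1%:R^-1) (N.+1%:R^-1) => a b c d; lra.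
(* E l - E (u n) is at most 2 (rnorm l + |M|) times the distance from u n to l;
   together with the defect 1 / (n + 1) of u n this accounts for C below. *)
have lm : E l <= m.
  suff lme (e : R) : 0 < e -> E l <= m + e by apply/ler_addgt0Pr.
  move=> e0.
  have M0 : 0 <= `|M| by [].
  set C := 1 + 2 * rnorm l + 2 * `|M|.
  have C0 : 0 < C by have := rnorm_ge0 l; rewrite /C; lra.
  set q : R := e / C; have q0 : 0 < q by rewrite divr_gt0.
  have qC : q * C = e by rewrite divfK// gt_eqF.
  have [N1 h1] := ul _ q0; have [N2 h2] := small _ q0.
  pose n := maxn N1 N2.
  have d1 := h1 n (leq_maxl _ _); have n1 := h2 n (leq_maxr _ _).
  have := DRe (u n) (l - u n); have := rnormD (u n) (l - u n).
  rewrite addrC subrK => tri Rel.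
  set d := rnorm (l - u n) in d1 tri.
  have d0 : 0 <= d by exact: rnorm_ge0.
  have l0 := rnorm_ge0 l; have u0 := rnorm_ge0 (u n).
  have l2 : rnorm l ^+ 2 <= rnorm (u n) ^+ 2 + 2 * (d * rnorm l).
    move: tri d0 l0 u0; clear d1; move: (rnorm l) (rnorm (u n)) d => a b c.
    have [ac|ac] := lerP a c; first by nra.
    move=> tri c0 a0 b0; have : (a - c) ^+ 2 <= b ^+ 2.
      by rewrite ler_pXn2r ?nnegrE// ?subr_ge0 ?(ltW ac)// lerBlDr.
    by nra.
  have Md : - Re (phi (l - u n)) <= `|M| * d.
    apply: le_trans (_ : M * d <= _); last by rewrite ler_wpM2r// ler_norm.
    by have := Rephi (l - u n); rewrite ler_norml lerNl => /andP[].
  have dl : d * rnorm l <= q * rnorm l by rewrite ler_wpM2r// ltW.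
  have dM : `|M| * d <= q * `|M| by rewrite mulrC ler_wpM2r// ltW.
  have := uE n; rewrite /E Rel -qC /C.
  move: n1 l2 Md dl dM; clear.
  move: (rnorm l) (rnorm (u n)) (Re (phi (u n))) (Re (phi (l - u n))).
  move: (n.+1%:R^-1) `|M| m d q; clear => k M m d q l un p r.
  lra.
exists l.
have Rel v : Re (phi v) = Re '[v, l].
  (* Along v the energy is E l + t a + t^2 b; at t = - a / (b + 1) it would be
     E l - t^2, below the minimum unless a = 0. *)
  set b := rnorm v ^+ 2.
  have b0 : 0 <= b by rewrite sqr_ge0.
  pose a := 2 * Re '[v, l] - 2 * Re (phi v).
  have := le_trans lm (mE (l + (- a / (b + 1))%:C *: v)).
  rewrite Eexp -/a -/b.
  set t := - a / (b + 1).
  have ta : t * (b + 1) = - a by rewrite /t divfK// gt_eqF// ltr_wpDl.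
  have [t0|t0] := eqVneq t 0.
    by move: ta; rewrite t0 mul0r /a => /eqP; rewrite eq_sym oppr_eq0 subr_eq0 => /eqP; lra.
  have : 0 < t ^+ 2 by rewrite lt_neqAle sqr_ge0 eq_sym sqrf_eq0 t0.
  move=> t2; suff -> : E l + t * a + t ^+ 2 * b = E l - t ^+ 2.
    by rewrite lerBrDr gerDl leNgt t2.
  by rewrite -[a]opprK -ta; ring.
move=> v; apply/eqP; rewrite eq_complex Rel eqxx/=.
have := Rel (('i)%C *: v); rewrite linearZ/= dotZl.
by case: (phi v) ('[v, l]) => [a b] [c d] /=; rewrite !mul0r !mul1r !sub0r => /oppr_inj ->.
Qed.

Section adjoint.
Context (R : realType) (V W : hilbertType R) (F : {linear V -> W}).
Hypothesis F_bounded : bounded_op F.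

Lemma adjointP v w : '[F v, w] = '[v, adjoint F w].
Proof.
suff [u Fu] : exists u, forall v, '[F v, w] = '[v, u].
  rewrite /adjoint.
  by apply: (xgetPex 0 (P := [set u | forall v, '[F v, w] = '[v, u]])); exists u.
have lin : linear_for *%R (fun v => '[F v, w]).
  by move=> a x y; rewrite linearP dotDl dotZl.
pose phi : {scalar V} := HB.pack (fun v => '[F v, w])
  (GRing.isLinear.Build _ _ _ _ (fun v => '[F v, w]) lin).
have [M M0 FM] := (bounded_op_rnormP _).1 F_bounded.
apply: (@riesz_representation _ _ phi (M * rnorm w)) => x /=.
apply: le_trans (cauchy_schwarz _ _) _.
by rewrite mulrAC ler_wpM2r ?rnorm_ge0.
Qed.

Lemma adjoint_linear : linear (adjoint F).
Proof.
move=> a x y; apply: dot_inj => v.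
by rewrite -adjointP !dotDr !dotZr -!adjointP.
Qed.

(** For [u = F^* w], [|u|^2 = '[F u, w] <= M |u| |w|]. *)
Lemma adjoint_bounded : bounded_op (adjoint F).
Proof.
have [M M0 FM] := (bounded_op_rnormP _).1 F_bounded.
apply/bounded_op_rnormP; exists M => // w.
set u := adjoint F w.
have [->|u0] := eqVneq (rnorm u) 0; first by rewrite mulr_ge0 ?rnorm_ge0.
have up : 0 < rnorm u by rewrite lt_neqAle eq_sym u0 rnorm_ge0.
rewrite -(ler_pM2l up).
have <- : normc '[F u, w] = rnorm u * rnorm u.
  rewrite adjointP dot_rnorm normcEsqrt/= expr0n/= addr0 sqrtr_sqr.
  by rewrite ger0_norm ?sqr_ge0// expr2.
apply: le_trans (cauchy_schwarz _ _) _.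
by rewrite mulrA ler_wpM2r ?rnorm_ge0// mulrC.
Qed.

End adjoint.

(** * Multiplication in L2 *)

Lemma ae_imply d (T : measurableType d) (R : realType)
    (mu : {measure set T -> \bar R}) (P Q : T -> Prop) :
  (forall x, P x -> Q x) -> (\forall x \ae mu, P x) -> \forall x \ae mu, Q x.
Proof. exact: filterS. Qed.

Lemma ae_imply2 d (T : measurableType d) (R : realType)
    (mu : {measure set T -> \bar R}) (P Q S : T -> Prop) :
  (forall x, P x -> Q x -> S x) -> (\forall x \ae mu, P x) ->
  (\forall x \ae mu, Q x) -> \forall x \ae mu, S x.
Proof. exact: filterS2. Qed.

Lemma ae_imply3 d (T : measurableType d) (R : realType)
    (mu : {measure set T -> \bar R}) (P Q S W : T -> Prop) :
  (forall x, P x -> Q x -> S x -> W x) -> (\forall x \ae mu, P x) ->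
  (\forall x \ae mu, Q x) -> (\forall x \ae mu, S x) -> \forall x \ae mu, W x.
Proof. exact: filterS3. Qed.

Lemma cmeasurable_real d (T : measurableType d) (R : realType) (h : T -> R) :
  measurable_fun [set: T] h -> cmeasurable (fun x => (h x)%:C).
Proof. by move=> mh; split=> //=; exact: measurable_cst. Qed.

Lemma continuous_inv_measurable (R : realType) (h : R -> R) :
  continuous h -> (forall x, h x != 0) -> measurable_fun [set: R] (fun x => (h x)^-1).
Proof.
move=> ch h0; apply: continuous_measurable_fun => x.
by apply: cvgV => //; exact: ch.
Qed.

Section L2.
Context d (T : measurableType d) (R : realType).
Variable mu : {measure set T -> \bar R}.
Implicit Types f g : L2 mu.

Lemma L2_cmeasurable f : cmeasurable f.
Proof. by have [] := L2_sqint f. Qed.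

Lemma cnorm2_le_ae (C : R) (f g : T -> R[i]) : 0 <= C ->
  cmeasurable f -> sqint mu g ->
  (\forall x \ae mu, normc (f x) <= C * normc (g x)) ->
  (cnorm2 mu f <= C%:E * cnorm2 mu g)%E.
Proof.
move=> C0 mf sg fg; have [mg _] := sg.
have -> : (C%:E * cnorm2 mu g = cnorm2 mu (fun x => C%:C * g x)%R)%E.
  by rewrite cnorm2Z// normcEsqrt/= expr0n/= addr0 sqrtr_sqr ger0_norm.
have mCg : cmeasurable (fun x => C%:C * g x).
  by apply: cmeasurableM => //; exact: cmeasurable_cst.
rewrite /cnorm2 unlock.
have mp (h : T -> R[i]) : cmeasurable h ->
    measurable_fun [set: T] (fun x => (`|(normc (h x))%:E| `^ 2)%E).
  move=> mh; apply: (measurableT_comp (measurable_poweR _)).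
  by apply: measurableT_comp => //; apply/measurable_EFinP/measurable_normc.
apply: gt0_ler_poweR; rewrite ?invr_ge0//.
- by rewrite in_itv/= leey andbT; apply: integral_ge0 => x _; rewrite lee_fin powR_ge0.
- by rewrite in_itv/= leey andbT; apply: integral_ge0 => x _; rewrite lee_fin powR_ge0.
apply: ae_ge0_le_integral => //; try exact: mp.
- by move=> x _; exact: poweR_ge0.
- by move=> x _; exact: poweR_ge0.
apply: filterS fg => x fg _ /=.
rewrite lee_fin ge0_ler_powR ?nnegrE// !ger0_norm ?normc_ge0//.
rewrite ComplexField.Normc.normcM.
by rewrite [X in X * _]normcEsqrt/= expr0n/= addr0 sqrtr_sqr ger0_norm.
Qed.

Lemma L2_rnormE f : rnorm f = fine (cnorm2 mu f).
Proof. by []. Qed.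

Lemma L2_rnorm_le (C : R) f g : 0 <= C ->
  (\forall x \ae mu, normc (f x) <= C * normc (g x)) -> rnorm f <= C * rnorm g.
Proof.
move=> C0 fg; rewrite -lee_fin EFinM !L2_rnormE !fineK ?cnorm2_fin//.
by apply: cnorm2_le_ae => //; [exact: L2_cmeasurable|exact: L2_sqint].
Qed.

Lemma L2_multiple_exists (g : T -> R[i]) (C : R) f : cmeasurable g ->
  (forall x, normc (g x) <= C) ->
  exists h : L2 mu, \forall x \ae mu, h x = g x * f x.
Proof.
move=> mg gC.
have C0 : 0 <= C := le_trans (normc_ge0 _) (gC point).
suff sgf : sqint mu (fun x => g x * f x).
  by exists (mkL2 sgf); apply: filterS (mkL2E sgf) => x; exact.
have mgf := cmeasurableM mg (L2_cmeasurable f).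
split=> //; apply: le_lt_trans (_ : (C%:E * cnorm2 mu f < +oo)%E); last first.
  by rewrite lte_mul_pinfty// ltey_eq cnorm2_fin.
apply: cnorm2_le_ae => //; first exact: L2_sqint.
by apply: nearW => x; rewrite ComplexField.Normc.normcM ler_wpM2r ?normc_ge0.
Qed.

Lemma L2_ae_inj f g : (\forall x \ae mu, f x = g x) -> f = g.
Proof. by move=> fg; apply/eqL2P; apply: filterS fg. Qed.

Lemma L2_comb a f g : \forall x \ae mu, (a *: f + g : L2 mu) x = a * f x + g x.
Proof.
by apply: filterS2 (L2_addE (a *: f) g) (L2_scaleE a f) => x -> ->.
Qed.

Lemma L2_dot_eq0 f g : (\forall x \ae mu, f x = 0 \/ g x = 0) -> L2_dot f g = 0.
Proof.
move=> fg0.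
have [mr mi] : cmeasurable (fun x => f x * (g x)^*).
  apply: cmeasurableM; first exact: L2_cmeasurable.
  have [mr mi] := L2_cmeasurable g; split=> /=.
    by apply: eq_measurable_fun mr => x _ /=; case: (g x).
  apply: eq_measurable_fun (measurable_funN mi) => x _ /=.
  by case: (g x).
have fgE : \forall x \ae mu, f x * (g x)^* = 0.
  apply: filterS fg0 => x [->|->]; first by rewrite mul0r.
  by rewrite rmorph0 mulr0.
have int0 (P : R[i] -> R) : P 0 = 0 ->
    measurable_fun [set: T] (fun x => P (f x * (g x)^*)) ->
    Rintegral mu [set: T] (fun x => P (f x * (g x)^*)) = 0.
  move=> P0 mP; rewrite /Rintegral (ae_eq_integral (cst 0%E)) ?integral0//.
    exact/measurable_EFinP.
  by apply: filterS fgE => x /= -> _; rewrite P0.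
by rewrite /L2_dot (int0 (@Re R))// (int0 (@complex.Im R)).
Qed.

End L2.

(** * The operator in its spectral representation *)

Section spectral.
Context (R : realType) (V : hilbertType R) (H : unbounded_op V).
Context (mu : {measure set (measurableTypeR R) -> \bar R}).
Context (U : {linear V -> L2 mu}).
Hypothesis HU : spectral_transformation H U.
Implicit Types (u v : V) (z : R[i]).
Local Notation hat v := (L2_fun (U v)).

Lemma rnormU v : rnorm (U v) = rnorm v.
Proof.
have [isoU _ _ _] := HU.
have := L2_dot_norm (U v); rewrite isoU dot_rnorm rnormE -rmorphXn/=.
move=> -[] /eqP; rewrite eqrXn2 ?rnorm_ge0// => /eqP <-//.
Qed.

Lemma hat_inj u v : (\forall x \ae mu, hat u x = hat v x) -> u = v.
Proof.
move=> /L2_ae_inj uv; apply/eqP; rewrite -subr_eq0; apply/eqP/rnorm_eq0.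
by rewrite -rnormU linearB uv subrr rnorm0.
Qed.

Lemma hat_comb a u v : \forall x \ae mu, hat (a *: u + v) x = a * hat u x + hat v x.
Proof. by rewrite linearP; exact: L2_comb. Qed.

Lemma hat_sub u v : \forall x \ae mu, hat (u - v) x = hat u x - hat v x.
Proof.
rewrite linearB; apply: filterS2 (L2_addE (U u) (- U v)) (L2_oppE (U v)).
by move=> x -> ->.
Qed.

Lemma hat_zero : \forall x \ae mu, hat 0 x = 0.
Proof. by rewrite linear0; exact: L2_zeroE. Qed.

Lemma hat_multiple_exists (g : R -> R[i]) (C : R) v :
  @cmeasurable _ (measurableTypeR R) R g -> (forall x, normc (g x) <= C) ->
  exists u, \forall x \ae mu, hat u x = g x * hat v x.
Proof.
move=> mg gC; have [h hE] := L2_multiple_exists (U v) mg gC.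
by have [_ /(_ h)[u uh] _ _] := HU; exists u; rewrite uh.
Qed.

Lemma rnorm_le_hat (C : R) u v : 0 <= C ->
  (\forall x \ae mu, normc (hat u x) <= C * normc (hat v x)) ->
  rnorm u <= C * rnorm v.
Proof. by move=> C0 uv; rewrite -!rnormU; exact: L2_rnorm_le. Qed.

(** The domain condition is absorbed: if [x * hat u x] is almost everywhere the
    transform of some [v], it is square integrable, so [u] is in the domain.
    Hence all questions about [H] become pointwise algebra. *)
Lemma graphP u v : (op_dom H u /\ H u = v) <->
  \forall x \ae mu, hat v x = x%:C * hat u x.
Proof.
have [_ _ domU HUe] := HU; split=> [[uH <-]|uv].
  rewrite HUe// /mult_op; case: pselect => [s|[]]; last exact: (domU u).1.
  by apply: filterS (mkL2E s) => x; exact.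
have mx : cmeasurable (fun x : measurableTypeR R => x%:C * hat u x).
  by apply: cmeasurableM (L2_cmeasurable _); exact: cmeasurable_real.
have su : sqint mu (fun x : R => x%:C * hat u x).
  split=> //; have [mv] := L2_sqint (U v).
  by have := ae_eq_cnorm2 mv mx uv; rewrite /finite_norm /cnorm2 => ->.
have uH : op_dom H u by apply/domU.
split=> //; apply: hat_inj; rewrite HUe// /mult_op.
case: pselect => // s; apply: filterS2 (mkL2E s) uv => x /(_ I) /= -> ->//.
Qed.

Lemma shift_graphP z u v : (op_dom H u /\ H u - z *: u = v) <->
  \forall x \ae mu, hat v x = (x%:C - z) * hat u x.
Proof.
have -> : (op_dom H u /\ H u - z *: u = v) <-> (op_dom H u /\ H u = z *: u + v).
  by split=> -[? e]; split=> //; [rewrite -e addrC subrK|rewrite e addrAC subrr add0r].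
apply: iff_trans (graphP _ _) _; split; apply: filterS2 (hat_comb z u v) => x ->.
  by move/(canRL (addKr _)) ->; ring.
by move=> ->; ring.
Qed.

Lemma eigenspaceP z u : op_eigenspace H z u <->
  \forall x \ae mu, (x%:C - z) * hat u x = 0.
Proof.
have -> : op_eigenspace H z u <-> (op_dom H u /\ H u - z *: u = 0).
  split=> -[? e]; split=> //; first by rewrite e subrr.
  by apply/eqP; rewrite -subr_eq0 e.
apply: iff_trans (shift_graphP _ _ _) _.
by split; apply: filterS2 hat_zero => x -> ->.
Qed.

(** For nonreal [z] the function [1 / (x - z)] is bounded by [1 / |Im z|], hence
    multiplies L2 into itself, and the product solves [(H - z) u = v]. *)
Lemma hat_resolvent z v : Im z != 0 ->
  \forall x \ae mu, hat (resolvent H z v) x = (x%:C - z)^-1 * hat v x.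
Proof.
case: z => a b /= b0; set z := a +i* b.
have z0 (x : R) : x%:C - z != 0.
  by rewrite eq_complex/= add0r oppr_eq0 (negbTE b0) andbF.
have [u uE] : exists u, \forall x \ae mu, hat u x = (x%:C - z)^-1 * hat v x.
  apply: (@hat_multiple_exists _ `|b|^-1) => [|x]; last first.
    rewrite ComplexField.Normc.normcV lef_pV2 ?posrE ?normr_gt0//; last first.
      rewrite lt_neqAle normc_ge0 eq_sym andbT; apply: contra (z0 x).
      by move/eqP/ComplexField.Normc.eq0_normc->.
    by rewrite normcEsqrt/= add0r sqrrN -sqrtr_sqr ler_wsqrtr// lerDr sqr_ge0.
  pose h x := ((x - a) ^+ 2 + b ^+ 2)^-1.
  have h0 x : (x - a) ^+ 2 + b ^+ 2 != 0.
    by rewrite gt_eqF// ltr_wpDl ?sqr_ge0// lt_neqAle sqr_ge0 eq_sym sqrf_eq0 b0.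
  have mh : measurable_fun [set: measurableTypeR R] h.
    apply: continuous_inv_measurable => // x.
    apply: cvgD (cvg_cst _); rewrite expr2.
    by apply: cvgM; apply: cvgB; by [exact: cvg_id|exact: cvg_cst].
  split.
    rewrite (_ : (fun _ => _) = (fun x => (x - a) * h x)).
      by apply: measurable_funM => //; exact: measurable_funB.
    by apply/funext => x /=; rewrite add0r sqrrN.
  rewrite (_ : (fun _ => _) = (fun x => b * h x)).
    exact: measurable_funM.
  by apply/funext => x /=; rewrite add0r sqrrN ?opprK mulNr opprK.
rewrite /resolvent (@xget_subset1 _ _ _ u)//.
  by apply/shift_graphP; apply: filterS uE => x ->; rewrite mulrA divff ?mul1r.
move=> u1 u2 /shift_graphP h1 /shift_graphP h2; apply: hat_inj.
by apply: filterS2 h1 h2 => x -> /(mulfI (z0 x)).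
Qed.

(** Eigenvectors for [l] are the vectors whose transform is concentrated on
    [l]; cutting [hat v] off to [l] leaves a remainder that vanishes at [l],
    hence is orthogonal to all of them. *)
Lemma hat_eigenprojection (l : R) v : \forall x \ae mu,
  hat (orth_proj (op_eigenspace H l%:C) v) x = (x == l)%:R * hat v x.
Proof.
have [p pE] : exists p, \forall x \ae mu, hat p x = (x == l)%:R * hat v x.
  apply: (@hat_multiple_exists _ 1) => [|x]; last first.
    by case: eqP => _; rewrite ?ComplexField.Normc.normc1 ?ComplexField.Normc.normc0.
  rewrite (_ : (fun _ => _) = (fun x => (\1_[set l] x : R)%:C)); last first.
    apply/funext => x; rewrite indicE (_ : (x \in [set l]) = (x == l)); first by case: eqP.
    by apply/idP/eqP => [/set_mem|->]; [|exact/mem_set].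
  by apply: cmeasurable_real; apply: measurable_indic.
have [isoU _ _ _] := HU.
rewrite /orth_proj (@xget_subset1 _ _ _ p)//.
  split.
    apply/eigenspaceP; apply: filterS pE => x ->.
    by case: eqP => [->|]; rewrite ?subrr ?mul0r ?mulr0.
  move=> q /eigenspaceP qE; rewrite -isoU; apply: L2_dot_eq0.
  apply: (ae_imply3 _ qE pE (hat_sub v p)) => x {}qE {}pE ->.
  rewrite pE; have [->|xl] := eqVneq x l; first by left; rewrite mul1r subrr.
  right; move/eqP: qE; rewrite mulf_eq0 subr_eq0 => /orP[/eqP[xl']|/eqP//].
  by rewrite xl' eqxx in xl.
(* Two orthogonal projections of v differ by an eigenvector orthogonal to itself. *)
move=> p1 p2 [/eigenspaceP e1 o1] [/eigenspaceP e2 o2].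
have e12 : op_eigenspace H l%:C (p1 - p2).
  apply/eigenspaceP; apply: (ae_imply3 _ e1 e2 (hat_sub p1 p2)) => x {}e1 {}e2 ->.
  by rewrite mulrBr e1 e2 subrr.
apply/eqP; rewrite -subr_eq0; apply/eqP/rnorm_eq0.
have := dot_rnorm (p1 - p2).
have -> : '[p1 - p2, p1 - p2] = '[v - p2, p1 - p2] - '[v - p1, p1 - p2].
  rewrite -dotBl (_ : v - p2 - (v - p1) = p1 - p2)//.
  by rewrite opprB addrC addrA subrK.
by rewrite o1// o2// subrr => -[] /esym/eqP; rewrite sqrf_eq0 => /eqP.
Qed.
End spectral.

(** * The gap around an isolated eigenvalue *)

Section gap.
Context (R : realType) (V : hilbertType R) (H : unbounded_op V).
Context (mu : {measure set (measurableTypeR R) -> \bar R}).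
Context (U : {linear V -> L2 mu}).
Hypothesis HU : spectral_transformation H U.
Implicit Types (u v : V) (z : R[i]).
Local Notation hat v := (L2_fun (U v)).

(** Let [M] bound the resolvent at [a] and [d = 1 / (M + 1)].  If [u] is [v]
    with its transform cut off to the ball of radius [d], then
    [|u| <= M |(H - a) u| <= M d |u|] with [M d < 1], so [u = 0]. *)
Lemma hat_null_near_resolvent_point (a : R) : resolvent_set H a%:C ->
  exists2 d : R, 0 < d &
    forall v, \forall x \ae mu, `|x - a| < d -> hat v x = 0.
Proof.
move=> [[_ inj _] /bounded_op_rnormP[M M0 resM]].
set d := (M + 1)^-1; have d0 : 0 < d by rewrite invr_gt0 ltr_wpDl.
exists d => // v.
pose A : set (measurableTypeR R) := [set` `]a - d, a + d[].
have AE (x : R) : (x \in A) = (`|x - a| < d).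
  by rewrite mem_setE in_itv/= ltr_norml; apply/andP/andP => -[? ?]; split; lra.
have mA : measurable_fun [set: measurableTypeR R] (\1_A : R -> R).
  by apply: measurable_indic; exact: measurable_itv.
have [u uE] : exists u, \forall x \ae mu, hat u x = (\1_A x : R)%:C * hat v x.
  apply: (hat_multiple_exists HU v (g := fun x => (\1_A x : R)%:C) (C := 1)) => [|x].
    exact: cmeasurable_real.
  by rewrite normc_real indicE; case: (_ \in _); rewrite ?normr1 ?normr0.
have [w wE] : exists w, \forall x \ae mu, hat w x = ((x - a) * \1_A x : R)%:C * hat v x.
  pose g x : R[i] := ((x - a) * \1_A x : R)%:C.
  apply: (hat_multiple_exists HU v (g := g) (C := d)) => [|x].
    by apply: cmeasurable_real; apply: measurable_funM => //; exact: measurable_funB.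
  rewrite /g normc_real indicE AE; case: ltP => [h|_]; first by rewrite mulr1 ltW.
  by rewrite mulr0 normr0 ltW.
have [uH Huw] : op_dom H u /\ H u - a%:C *: u = w.
  apply/(shift_graphP HU); move: uE wE; apply: filterS2 => x -> ->.
  by rewrite rmorphM rmorphB/= mulrA.
have res_u : resolvent H a%:C w = u.
  rewrite /resolvent; apply: xget_subset1 => // u1 u2 [h1 e1] [h2 e2].
  by apply: inj; rewrite ?inE// e1 e2.
have wu : rnorm w <= d * rnorm u.
  apply: (rnorm_le_hat HU) (ltW d0) _; move: uE wE; apply: filterS2 => x -> ->.
  rewrite !ComplexField.Normc.normcM !normc_real normrM mulrA -mulrA.
  rewrite indicE AE mulrA; case: ltP => [h|_]; last by rewrite normr0 !mulr0 !mul0r.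
  by rewrite normr1 !mulr1 ler_wpM2r ?normc_ge0// ltW.
have u0 : rnorm u = 0.
  apply/eqP; rewrite eq_le rnorm_ge0 andbT.
  have := resM w; rewrite res_u => /le_trans /(_ (ler_wpM2l M0 wu)).
  rewrite mulrA -subr_ge0 -{2}[rnorm u]mul1r -mulrBl.
  have -> : M * d - 1 = - d.
    by rewrite -[X in _ - X](mulfV (x := M + 1)) ?gt_eqF ?ltr_wpDl// -/d; ring.
  by rewrite mulNr oppr_ge0 pmulr_rle0.
rewrite (rnorm_eq0 u0) in uE.
move: uE (hat_zero U); apply: filterS2 => x -> + xd.
by rewrite indicE AE xd mul1r.
Qed.

(** Around each point of the punctured neighbourhood there is an interval on
    which all transforms vanish, but its length is not controlled as the point
    moves.  Shrinking to rational end points leaves countably many intervals,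
    so that the exceptional null sets add up to a null set. *)
Lemma spectral_gap (l : R) : isolated_eigenvalue H l%:C ->
  exists2 e : R, 0 < e &
    forall v, \forall x \ae mu, `|x - l| < e -> x != l -> hat v x = 0.
Proof.
move=> [_ [_ [W Wl WE]]].
have [e e0 eW] : exists2 e : R, 0 < e &
    forall x : R, `|x - l| < e -> W x%:C.
  move/nbhs_ballP : Wl => [e /= e0 eW].
  have eR : e = (Re e)%:C by rewrite RRe_real// gtr0_real.
  exists (Re e); first by rewrite -ltcR -eR.
  move=> x xl; apply: eW; rewrite -ball_normE/= eR -rmorphB normrCE normc_real.
  by rewrite ltcR distrC.
exists e => // v.
have res x : `|x - l| < e -> x != l -> resolvent_set H x%:C.
  move=> xe xl; apply: contrapT => nres.
  have : (W `&` spectrum H) x%:C by split=> //; exact: eW.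
  by rewrite WE => /= -[] xl'; rewrite xl' eqxx in xl.
pose null (pq : rat * rat) := forall u, \forall x \ae mu,
  ratr pq.1 < x < ratr pq.2 -> hat u x = 0.
have : \forall x \ae mu, forall n : nat, forall pq, unpickle n = Some pq ->
    null pq -> ratr pq.1 < x < ratr pq.2 -> hat v x = 0.
  apply/ae_foralln => n; case: (unpickle n) => [pq|]; last exact: nearW.
  have [npq|npq] := pselect (null pq); last by apply: nearW => x ? [<-] /npq.
  by move: (npq v); apply: ae_imply => x h ? [<-] _.
move=> aeQ; apply: (ae_imply _ aeQ) => x hx xe xl.
have [d d0 dv] := hat_null_near_resolvent_point (res x xe xl).
have xd1 : x - d < x by rewrite ltrBlDr ltrDl.
have xd2 : x < x + d by rewrite ltrDl.
have [p] := rat_in_itvoo xd1; rewrite in_itv/= => /andP[p1 p2].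
have [q] := rat_in_itvoo xd2; rewrite in_itv/= => /andP[q1 q2].
apply: (hx (pickle (p, q)) (p, q)); rewrite ?pickleK//= ?p2 ?q1// => u.
apply: (ae_imply _ (dv u)) => y yd /andP[py yq]; apply: yd.
by rewrite ltr_norml; apply/andP; split; lra.
Qed.

End gap.

(** * The reduced resolvent as a norm limit *)

Lemma resolvent_diff_le (R : realType) (e y t : R) : 0 < e -> 0 < y -> e <= `|t| ->
  normc ((t%:C - ('i * y%:C))^-1 - (t^-1)%:C) <= y / e ^+ 2.
Proof.
move=> e0 y0 et.
have t0 : t != 0 by rewrite -normr_gt0 (lt_le_trans e0).
have tC : t%:C != 0 by rewrite (_ : 0 = 0%:C)// eq_complex/= eqxx andbT.
have ny : e <= normc (t%:C - 'i * y%:C).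
  apply: le_trans et (le_trans _ (normRe_le_normc _)).
  by rewrite /= !(mul0r, mul1r, subr0, subrr, oppr0, addr0).
have yC : t%:C - 'i * y%:C != 0.
  by apply: contraTneq ny => ->; rewrite ComplexField.Normc.normc0 -ltNge.
have -> : (t%:C - 'i * y%:C)^-1 - (t^-1)%:C =
    'i * y%:C * (t%:C - 'i * y%:C)^-1 * (t%:C)^-1.
  by rewrite fmorphV/=; field; rewrite tC yC.
rewrite !ComplexField.Normc.normcM !ComplexField.Normc.normcV !normc_real.
rewrite (ger0_norm (ltW y0)) (_ : normc 'i = 1); last first.
  by rewrite normcEsqrt/= expr0n/= add0r expr1n sqrtr1.
rewrite mul1r -mulrA -invfM ler_pM2l// lef_pV2 ?posrE ?exprn_gt0//; last first.
  by rewrite mulr_gt0 ?normr_gt0// (lt_le_trans e0).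
by rewrite expr2 ler_pM// ltW.
Qed.

Section reduced_resolvent.
Context (R : realType) (V : hilbertType R) (H : unbounded_op V).
Context (mu : {measure set (measurableTypeR R) -> \bar R}).
Context (U : {linear V -> L2 mu}).
Hypothesis HU : spectral_transformation H U.
Local Notation hat v := (L2_fun (U v)).

Lemma bounded_real_function (g : R -> R) (C : R) :
  measurable_fun [set: measurableTypeR R] g -> (forall x, `|g x| <= C) ->
  exists S : {linear V -> V}, (forall v, rnorm (S v) <= C * rnorm v) /\
    forall v, \forall x \ae mu, hat (S v) x = (g x)%:C * hat v x.
Proof.
move=> mg gC; have C0 : 0 <= C := le_trans (normr_ge0 _) (gC 0).
have /choice[S SE] : forall v, exists u,
    \forall x \ae mu, hat u x = (g x)%:C * hat v x.
  move=> v; apply: (hat_multiple_exists HU v (g := fun x => (g x)%:C) (C := C)) => [|x].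
    exact: cmeasurable_real.
  by rewrite normc_real.
have Slin : linear S.
  move=> a u v; apply: (hat_inj HU).
  have e1 : \forall x \ae mu,
      hat (S (a *: u + v)) x = (g x)%:C * (a * hat u x + hat v x).
    by apply: (ae_imply2 _ (SE (a *: u + v)) (hat_comb U a u v)) => x -> ->.
  have e2 : \forall x \ae mu,
      hat (a *: S u + S v) x = (g x)%:C * (a * hat u x + hat v x).
    apply: (ae_imply3 _ (hat_comb U a (S u) (S v)) (SE u) (SE v)) => x -> -> ->.
    by ring.
  by apply: (ae_imply2 _ e1 e2) => x -> ->.
pose T : {linear V -> V} := HB.pack S (GRing.isLinear.Build _ _ _ _ S Slin).
exists T; split=> // v; apply: (rnorm_le_hat HU) => //.
apply: (ae_imply _ (SE v)) => x ->.
by rewrite ComplexField.Normc.normcM normc_real ler_wpM2r ?normc_ge0.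
Qed.

(** The limit operator [S] is the reduced resolvent, multiplication by
    [1 / (x - l)] off the gap.  It is realised by a continuous bounded function
    that agrees with it there and vanishes at [l], so that it needs no cut-off
    and annihilates the eigenspace just as [Q] does. *)
Lemma reduced_resolvent_approx (l : R) : isolated_eigenvalue H l%:C ->
  let Q v := v - orth_proj (op_eigenspace H l%:C) v in
  exists S : {linear V -> V}, bounded_op S /\
  exists2 C : R, 0 <= C & forall y v, 0 < y ->
    rnorm (Q (resolvent H (l +i* y) (Q v)) - S v) <= C * y * rnorm v.
Proof.
move=> iso Q; have [e e0 gap] := spectral_gap HU iso.
pose m x : R := Num.max (e ^+ 2) ((x - l) ^+ 2).
have e2m x : e ^+ 2 <= m x by rewrite le_max lexx.
have xm x : (x - l) ^+ 2 <= m x by rewrite le_max lexx orbT.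
have m0 x : 0 < m x by apply: lt_le_trans (e2m x); rewrite exprn_gt0.
have [] := @bounded_real_function (fun x => (x - l) * (m x)^-1) e^-1.
- apply: measurable_funM; first exact: measurable_funB.
  apply: continuous_inv_measurable => [x|x]; last by rewrite gt_eqF.
  apply: (@continuous_max R R (cst (e ^+ 2)) (fun x => (x - l) * (x - l)) x).
    exact: cvg_cst.
  by apply: cvgM; apply: cvgB; by [exact: cvg_id|exact: cvg_cst].
- move=> x; rewrite normrM normfV (gtr0_norm (m0 x)) ler_pdivrMr//.
  rewrite -(ler_pM2l e0) mulrA mulfV ?gt_eqF// mul1r.
  have := e2m x; have := xm x; rewrite -(real_normK (num_real (x - l))).
  by have := normr_ge0 (x - l); nra.
move=> S [Sb SE]; exists S; split.
  by apply/bounded_op_rnormP; exists e^-1; rewrite ?invr_ge0 ?ltW.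
exists (e ^+ 2)^-1 => [|y v y0]; first by rewrite invr_ge0 sqr_ge0.
apply: (rnorm_le_hat HU); first by rewrite mulr_ge0 ?invr_ge0 ?sqr_ge0 ?ltW.
have QE u : \forall x \ae mu, hat (Q u) x = (x != l)%:R * hat u x.
  have h := hat_sub U u (orth_proj (op_eigenspace H l%:C) u).
  apply: (ae_imply2 _ h (hat_eigenprojection HU l u)) => x -> ->.
  by case: eqP => _ /=; rewrite ?mul1r ?mul0r ?subrr ?subr0.
set r := resolvent H (l +i* y) (Q v).
have rE : \forall x \ae mu, hat r x = (x%:C - (l +i* y))^-1 * hat (Q v) x.
  by apply: (hat_resolvent HU); rewrite gt_eqF.
have DE : \forall x \ae mu, hat (Q r - S v) x =
    ((x != l)%:R * (x%:C - (l +i* y))^-1 - ((x - l) / m x)%:C) * hat v x.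
  have e1 : \forall x \ae mu,
      hat (Q r) x = (x != l)%:R * (x%:C - (l +i* y))^-1 * hat v x.
    apply: (ae_imply3 _ (QE r) rE (QE v)) => x -> -> ->.
    by case: eqP => _; rewrite /= ?mul1r ?mul0r.
  apply: (ae_imply3 _ (hat_sub U (Q r) (S v)) e1 (SE v)) => x -> -> ->.
  by rewrite [RHS]mulrBl.
(* Both multipliers vanish at l, hat v vanishes in the rest of the gap, and
   outside the gap the multipliers are 1 / (t - i y) and 1 / t. *)
apply: (ae_imply2 _ DE (gap v)) => x -> vx.
have [->|xl] := eqVneq x l.
  rewrite mul0r subrr mul0r subr0 mul0r ComplexField.Normc.normc0.
  by rewrite !mulr_ge0 ?normc_ge0 ?invr_ge0 ?sqr_ge0 ?ltW.
have [xe|xe] := ltP `|x - l| e.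
  by rewrite (vx xe xl) mulr0 ComplexField.Normc.normc0 mulr0.
rewrite ComplexField.Normc.normcM ler_wpM2r ?normc_ge0// mul1r.
have -> : (x - l) / m x = (x - l)^-1.
  rewrite /m max_r; first by rewrite expr2 invfM mulrA mulfV ?mul1r// subr_eq0.
  by rewrite -[leRHS]real_normK ?num_real// ler_pXn2r ?nnegrE// ltW.
have -> : x%:C - (l +i* y) = (x - l)%:C - 'i * y%:C.
  apply/eqP; rewrite eq_complex/=.
  by rewrite !(mul0r, mul1r, mulr0, sub0r, add0r, addr0, subr0, oppr0) !eqxx.
by rewrite [leRHS]mulrC; exact: (resolvent_diff_le e0 y0 xe).
Qed.

End reduced_resolvent.

Lemma opnorm_cvg0 (R : realType) (V W : normedModType R[i]) (D : R -> V -> W) (C : R) :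
  (forall y v, 0 < y -> rnorm (D y v) <= C * y * rnorm v) ->
  0 <= C -> opnorm (D y) @[y --> 0^'+] --> 0%E.
Proof.
move=> DC C0; apply: (@squeeze_cvge _ _ _ _ (cst 0%E) _ (fun y => (C * y)%:E)).
- near=> y; have y0 : 0 < y by [].
  apply/andP; split.
    apply: (@le_trans _ _ (rnorm (D y 0))%:E); first by rewrite lee_fin rnorm_ge0.
    by rewrite /opnorm; apply: ereal_sup_ubound; exists 0 => //=; rewrite normr0.
  apply: ge_ereal_sup => _ [v /= v1 <-]; rewrite lee_fin.
  apply: le_trans (DC y v y0) _; rewrite ler_piMr ?mulr_ge0 ?(ltW y0)//.
  by move: v1; rewrite rnormE (_ : 1 = 1%:C)// lecR.
- exact: cvg_cst.
- apply: cvg_EFin; first exact: nearW.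
  apply: (@cvg_at_right_filter _ _ (fun y : R => C * y)).
  by rewrite -[X in _ --> X](mulr0 C); apply: cvgM; [exact: cvg_cst|exact: cvg_id].
Unshelve. all: by end_near. Qed.

(** * The rigging operator *)

Lemma C0_bounded (R : realType) (w : R -> R) : C0 w ->
  exists C : R, forall x, `|w x| <= C.
Proof.
move=> [cw wpy wny].
have [a aw] : exists a : R, forall x, a < x -> `|w x| < 1.
  move/cvgrPdist_lt : wpy => /(_ 1 ltr01)[a [_ aw]]; exists a => x /aw /=.
  by rewrite sub0r normrN.
have [b bw] : exists b : R, forall x, x < b -> `|w x| < 1.
  move/cvgrPdist_lt : wny => /(_ 1 ltr01)[b [_ bw]]; exists b => x /bw /=.
  by rewrite sub0r normrN.
have ba : Num.min a b <= Num.max a b by rewrite ge_min le_max lexx.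
have [|c _ cw'] := @EVT_max R (fun x => `|w x|) _ _ ba.
  by apply: continuous_subspaceT => x; apply: cvg_norm; exact: cw.
exists (Num.max 1 `|w c|) => x; rewrite le_max.
have [xa|xa] := ltP (Num.max a b) x.
  by rewrite ltW// aw// (le_lt_trans _ xa)// le_max lexx.
have [xb|xb] := ltP x (Num.min a b).
  by rewrite ltW// bw// (lt_le_trans xb)// ge_min lexx orbT.
by apply/orP; right; apply: cw'; rewrite in_itv/= xb xa.
Qed.

Section weight.
Context (R : realType) (mu : {measure set (measurableTypeR R) -> \bar R}).
Variable w : R -> R.
Hypothesis wC0 : C0 w.

Lemma weight_opE (f : L2 mu) : \forall x \ae mu, weight_op w f x = (w x)%:C * f x.
Proof.
have [C wC] := C0_bounded wC0.
have mw : @cmeasurable _ (measurableTypeR R) R (fun x => (w x)%:C).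
  by apply: cmeasurable_real; case: wC0 => cw _ _; exact: continuous_measurable_fun.
have wC' x : normc (w x)%:C <= C by rewrite normc_real.
have [h hE] := @L2_multiple_exists _ (measurableTypeR R) R mu _ C f mw wC'.
rewrite /weight_op /mult_op; case: pselect => [s|[]].
  by apply: (ae_imply _ (mkL2E s)) => x; exact.
have mwf := cmeasurableM mw (L2_cmeasurable f).
split=> //; have [mh] := L2_sqint h.
by have := ae_eq_cnorm2 mh mwf hE; rewrite /finite_norm /cnorm2 => ->.
Qed.

Lemma weight_op_linear : linear (@weight_op R mu w).
Proof.
move=> a f g; apply: L2_ae_inj.
have e1 : \forall x \ae mu,
    weight_op w (a *: f + g) x = (w x)%:C * (a * L2_fun f x + L2_fun g x).
  by apply: (ae_imply2 _ (weight_opE (a *: f + g)) (L2_comb a f g)) => x -> ->.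
have e2 : \forall x \ae mu,
    (a *: weight_op w f + weight_op w g : L2 mu) x =
    (w x)%:C * (a * L2_fun f x + L2_fun g x).
  have h := L2_comb a (weight_op w f) (weight_op w g).
  apply: (ae_imply3 _ h (weight_opE f) (weight_opE g)) => x -> -> ->.
  by ring.
by apply: (ae_imply2 _ e1 e2) => x -> ->.
Qed.

Lemma weight_op_bounded : exists2 C : R, 0 <= C &
  forall f, rnorm (@weight_op R mu w f) <= C * rnorm f.
Proof.
have [C wC] := C0_bounded wC0.
have C0 : 0 <= C := le_trans (normr_ge0 _) (wC 0).
exists C => // f; apply: L2_rnorm_le => //.
apply: (ae_imply _ (weight_opE f)) => x ->.
by rewrite ComplexField.Normc.normcM normc_real ler_wpM2r ?normc_ge0.
Qed.

End weight.

Theorem theorem0p7 (R : realType)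
  (V K : hilbertType R) (sepV : separable V) (sepK : separable K)
  (H : unbounded_op V) (saH : self_adjoint H)
  (mu : {measure set (measurableTypeR R) -> \bar R})
  (U : {linear V -> L2 mu}) (HU : spectral_transformation H U)
  (w : R -> R) (w_gt0 : forall x, 0 < w x) (w_C0 : C0 w)
  (J : {linear L2 mu -> K}) (J_bounded : bounded_op J)
  (lambda : R) (lambda_isolated : isolated_eigenvalue H lambda%:C)
  (lambda_finite : finite_dim (op_eigenspace H lambda%:C))
  (lambda_holder : holder_at (measure_off mu lambda) lambda) :
  let F : V -> K := rigging U w J in
  let P : V -> V := orth_proj (op_eigenspace H lambda%:C) in
  let Q : V -> V := fun v => v - P v in
  exists L : {linear K -> K}, bounded_op L /\
    opnorm (fun k => (F \o Q \o resolvent H (lambda +i* y) \o Q \o adjoint F) k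
                     - L k) @[y --> 0^'+] --> 0%E.
Proof.
move=> F0 P Q.
have Flin : linear F0.
  by move=> a u v; rewrite /F0/= /rigging/= linearP (weight_op_linear w_C0) linearP.
pose F : {linear V -> K} := HB.pack F0 (GRing.isLinear.Build _ _ _ _ F0 Flin).
have [MF MF0 Fb] : exists2 M : R, 0 <= M & forall v, rnorm (F v) <= M * rnorm v.
  have [Mw Mw0 wb] := weight_op_bounded mu w_C0.
  have [MJ MJ0 Jb] := (bounded_op_rnormP _).1 J_bounded.
  exists (MJ * Mw) => [|v]; first exact: mulr_ge0.
  apply: le_trans (Jb _) _; rewrite -mulrA ler_wpM2l//.
  by rewrite -(rnormU HU); exact: wb.
have Fbd : bounded_op F by apply/bounded_op_rnormP; exists MF.
have [MA MA0 Ab] := (bounded_op_rnormP _).1 (adjoint_bounded Fbd).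
have [S [/bounded_op_rnormP[MS MS0 Sb] [C C0 SC]]] :=
  reduced_resolvent_approx HU lambda_isolated.
pose L0 := F \o S \o adjoint F.
have Llin : linear L0.
  move=> a k k'; rewrite -[LHS]/(F (S (adjoint F (a *: k + k')))).
  by rewrite (adjoint_linear Fbd) (linearP S) (linearP F).
pose L : {linear K -> K} := HB.pack L0 (GRing.isLinear.Build _ _ _ _ L0 Llin).
exists L; split.
  apply/bounded_op_rnormP; exists (MF * (MS * MA)) => [|k]; first by rewrite !mulr_ge0.
  apply: le_trans (Fb _) _; rewrite -!mulrA ler_wpM2l//.
  by apply: le_trans (Sb _) _; rewrite ler_wpM2l//; exact: Ab.
apply: (@opnorm_cvg0 _ _ _ _ (MF * (C * MA))); last by rewrite !mulr_ge0.
move=> y k y0 /=.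
rewrite -[X in rnorm (X - _)]/(F _) -[X in rnorm (_ - X)]/(F (S (adjoint F k))).
rewrite -linearB.
apply: le_trans (Fb _) _; rewrite -!mulrA ler_wpM2l//.
apply: le_trans (SC y _ y0) _.
by rewrite -mulrA ler_wpM2l// [MA * _]mulrCA ler_wpM2l // ?ltW//; exact: Ab.
Qed.
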